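(* Let $0<\beta\le1$ and $\alpha,p>0$. The space fractional Polya process $\{\widetilde W^\Gamma_\beta(t)\}_{t\ge0}$ has stationary increments and is stochastically continuous.
   Context: $\{D_\beta(t)\}_{t\ge0}$ is the $\beta$-stable subordinator, $\mathbb{E}[e^{-sD_\beta(t)}]=e^{-ts^\beta}$ ($D_1(t)=t$); $\{N(t,\lambda)\}_{t\ge0}$ is a Poisson process of rate $\lambda$, independent of $D_\beta$; $\Gamma$ is a random variable with the gamma density $g(y|\alpha,p)=\frac{\alpha^p}{\Gamma(p)}y^{p-1}e^{-\alpha y}$, $y>0$, independent of $\{D_\beta(t)\}$ and $\{N(t,\lambda)\}$. The space fractional Poisson process is $\widetilde N_\beta(t,\lambda)=N(D_\beta(t),\lambda)$, and the space fractional Polya process (SFPP) is $\widetilde W^\Gamma_\beta(t)=\widetilde N_\beta(t,\Gamma)=N(D_\beta(t),\Gamma)$, i.e. conditionally on $\Gamma=\lambda$ it is the process $N(D_\beta(t),\lambda)$. *)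

(* Defs.v *)
From HB Require Import structures.
From mathcomp Require Import all_boot all_order all_algebra.
From mathcomp Require Import all_classical all_reals all_analysis.

Set Implicit Arguments.
Unset Strict Implicit.
Unset Printing Implicit Defensive.

Import Order.TTheory GRing.Theory Num.Theory.
Import numFieldNormedType.Exports.

Local Open Scope classical_set_scope.
Local Open Scope ring_scope.

(* A real process {X(t)}_{t >= 0} is a function X : R -> {RV P >-> R}; its
   values at negative times are never constrained nor used. *)

Section processes.
Context d (T : measurableType d) (R : realType) (P : probability T R).
Implicit Types X : R -> {RV P >-> R}.

Definition increment X (s t : R) : T -> R := fun w => X t w - X s w.

(* Increments over finitely many consecutive intervals are mutually
   independent; taking B i = setT yields the product rule on subfamilies. *)
Definition independent_increments X : Prop :=
  forall (n : nat) (t : nat -> R) (B : nat -> set R),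
    0 <= t 0%N -> (forall i, (i < n)%N -> t i <= t i.+1) ->
    (forall i, measurable (B i)) ->
    P [set w | forall i, (i < n)%N -> B i (increment X (t i) (t i.+1) w)] =
    (\prod_(i < n) P (increment X (t i) (t i.+1) @^-1` B i))%E.

Definition stationary_increments X : Prop :=
  forall s t : R, 0 <= s -> 0 <= t -> forall B : set R, measurable B ->
    P (increment X s (s + t) @^-1` B) = P (increment X 0 t @^-1` B).

Definition stochastically_continuous X : Prop :=
  forall t : R, 0 <= t -> forall e : R, 0 < e ->
    P [set w | e < `|X s w - X t w|]
      @[s --> within [set s : R | 0 <= s] (nbhs t)] --> 0%E.

(* Left limits come for free from monotonicity. *)
Definition nondecreasing_cadlag_paths X : Prop :=
  forall w : T,
    (forall s t : R, 0 <= s -> s <= t -> X s w <= X t w) /\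
    (forall t : R, 0 <= t -> X s w @[s --> t^'+] --> X t w).

Definition stable_subordinator (beta : R) (D : R -> {RV P >-> R}) : Prop :=
  [/\ forall w, D 0 w = 0,
      nondecreasing_cadlag_paths D,
      independent_increments D,
      stationary_increments D &
      forall s t : R, 0 <= s -> 0 <= t ->
        ('E_P[fun w => expR (- s * D t w)] = (expR (- t * s `^ beta))%:E)%E].

(* The law of the increments is required for s < t only, because
   poisson_pmf 0 k is 1 for every k. *)
Definition poisson_process (lam : R) (N : R -> {RV P >-> R}) : Prop :=
  [/\ forall w, N 0 w = 0,
      forall (t : R) (w : T), 0 <= t -> N t w \is a Num.nat,
      nondecreasing_cadlag_paths N,
      independent_increments N &
      forall (s t : R) (k : nat), 0 <= s -> s < t ->
        P (increment N s t @^-1` [set k%:R]) =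
          (poisson_pmf (lam * (t - s)) k)%:E].

Definition process_events X : set_system T :=
  \bigcup_(t in [set t : R | 0 <= t]) preimage_set_system setT (X t) measurable.

Definition independent_classes (F G : set_system T) : Prop :=
  forall A B, F A -> G B -> P (A `&` B) = (P A * P B)%E.

Definition independent_processes X Y : Prop :=
  independent_classes <<s process_events X >> <<s process_events Y >>.

Definition rv_independent_of_processes (Z : {RV P >-> R}) X Y : Prop :=
  independent_classes (preimage_set_system setT Z measurable)
                      <<s process_events X `|` process_events Y >>.

Definition gamma_fun (p : R) : R :=
  \int[lebesgue_measure]_(y in `]0, +oo[) (y `^ (p - 1) * expR (- y)).

Definition gamma_pdf (alpha p y : R) : R :=
  if 0 < y then
    alpha `^ p / gamma_fun p * y `^ (p - 1) * expR (- alpha * y)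
  else 0.

Definition gamma_distributed (alpha p : R) (Z : {RV P >-> R}) : Prop :=
  forall B : set R, measurable B ->
    distribution P Z B =
      (\int[lebesgue_measure]_(y in B) (gamma_pdf alpha p y)%:E)%E.

(* N(D(t), lambda), where Nlam is {N(t, lambda)}_{t >= 0} *)
Definition space_fractional_poisson (D Nlam : R -> {RV P >-> R})
    (t : R) (w : T) : R := Nlam (D t w) w.

(* N lam t stands for N(t, lambda).  The first clause is the formula
   W(t) = N(D(t), Gam).  Alone it does not determine the law of W: modifying
   N lam on the null event [Gam = lam] for each lam preserves the law of every
   N lam and its independence of (D, Gam), but may change N(D(t), Gam)
   everywhere.  The second clause is its intended meaning: the conditional
   finite-dimensional laws of W given Gam = lam are those of N(D(t), lam), in
   disintegrated form. *)
Definition space_fractional_polya (D : R -> {RV P >-> R})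
    (N : R -> R -> {RV P >-> R}) (Gam : {RV P >-> R})
    (W : R -> {RV P >-> R}) : Prop :=
  (forall (t : R) (w : T), 0 <= t -> 0 < Gam w ->
     W t w = space_fractional_poisson D (N (Gam w)) t w) /\
  (forall (n : nat) (t : 'I_n -> R) (B : 'I_n -> set R) (A : set R),
     (forall i, 0 <= t i) -> (forall i, measurable (B i)) ->
     measurable A -> A `<=` `]0, +oo[ ->
     P (Gam @^-1` A `&` [set w | forall i, B i (W (t i) w)]) =
     (\int[distribution P Gam]_(lam in A)
        P [set w | forall i,
             B i (space_fractional_poisson D (N lam) (t i) w)])%E).

End processes.

(* Main.v *)
Require Import Defs.
From HB Require Import structures.
From mathcomp Require Import all_boot all_order all_algebra.
From mathcomp Require Import all_classical all_reals all_analysis.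
From mathcomp Require Import measurable_realfun.

Set Implicit Arguments.
Unset Strict Implicit.
Unset Printing Implicit Defensive.

Import Order.TTheory GRing.Theory Num.Theory.
Import numFieldNormedType.Exports.

Local Open Scope classical_set_scope.
Local Open Scope ring_scope.

(** Conditionally on [Gam = lam], the process [W] is a Poisson process [N lam]
    run at the independent clock [D].  The Poisson process has independent
    increments whose law depends on the elapsed time only, so, given the clock,
    the numbers of events before [D s] and between [D s] and [D (s + t)] are
    independent with Poisson laws of means [lam * D s] and
    [lam * (D (s + t) - D s)] ([poisson_at_random_times]).  Summing over the
    first number and integrating over [lam] gives the law of the increment of
    [W] ([sfpp_increment_law]):

      P (W (s + t) - W s = m, Gam > 0)
        = \int_(lam > 0) E [poisson_weight (lam * (D (s + t) - D s)) m].

    The right-hand side sees the clock only through the law of its increment,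
    so the stationarity of the increments of [D] passes to [W].  Integer values
    make this countable: [W] is integer-valued where [Gam > 0], an event of
    probability one, hence the law of an increment is given by its atoms and
    only events on two integer values of [W] are needed.

    The substitution of the random times [U = D s <= V = D (s + t)] in the
    Poisson process is justified by rounding them up, strictly, to the grid
    [{k / (n + 1)}].  For the rounded times the claim is a countable sum over
    the grid cells, on each of which independence applies at deterministic
    times.  As [n] grows the rounded times decrease to [U] and [V]: the counts
    are eventually equal to those at [U] and [V] by right-continuity, and the
    Poisson weights are continuous, so dominated convergence concludes.

    For stochastic continuity, stationarity reduces [P (`|W s - W t| > e)] to
    [P (W h - W 0 > e)] with [h = `|s - t|].  Where [Gam > 0] the path of [W]
    is nondecreasing and, as [D] and [N] are right-continuous at [0], the event
    [W h - W 0 > e] shrinks to nothing as [h] decreases to [0]. *)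

(** * Poisson weights *)

Section poisson_weight.
Context (R : realType).
Implicit Types (x : R) (k : nat).

(** The Poisson probability of [k] for the mean [`|x|].  Unlike [poisson_pmf],
    which is constantly [1] at mean [0], it gives the Dirac mass at [0] there
    and is continuous in the mean, as limits of random means require; the
    absolute value makes it nonnegative on the whole line, as Tonelli's theorem
    requires. *)
Definition poisson_weight (x : R) (k : nat) : R :=
  `|x| ^+ k / k`!%:R * expR (- `|x|).

Lemma poisson_weight_ge0 x k : 0 <= poisson_weight x k.
Proof. by rewrite !mulr_ge0// ?expR_ge0// exprn_ge0. Qed.

Lemma poisson_weight_pmf x k : 0 < x -> poisson_weight x k = poisson_pmf x k.
Proof. by move=> x0; rewrite /poisson_weight /poisson_pmf x0 gtr0_norm. Qed.

Lemma continuous_poisson_weight k : continuous (poisson_weight ^~ k).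
Proof.
have cn : continuous (fun x : R => `|x|) by exact: norm_continuous.
move=> x; apply: cvgM; last first.
  apply: (@continuous_comp _ _ _ (fun y : R => - `|y|) expR) => //.
    by apply: cvgN; exact: cn.
  exact: continuous_expR.
apply: cvgM; last exact: cvg_cst.
apply: (@continuous_comp _ _ _ (fun y : R => `|y|) (fun y : R => y ^+ k)) => //.
  exact: cn.
exact: exprn_continuous.
Qed.

Lemma measurable_poisson_weight d (T : measurableType d) (D : set T)
    (f : T -> R) k :
  measurable_fun D f -> measurable_fun D (fun w => poisson_weight (f w) k).
Proof.
apply: (@measurableT_comp _ _ _ _ _ _ (poisson_weight ^~ k)).
by apply: continuous_measurable_fun; exact: continuous_poisson_weight.
Qed.

Lemma poisson_weight_sum x : (\sum_(k <oo) (poisson_weight x k)%:E = 1)%E.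
Proof.
transitivity ((expR (- `|x|))%:E * (expR `|x|)%:E)%E; last first.
  by rewrite -EFinM -expRD addNr expR0.
under eq_eseriesr do rewrite /poisson_weight mulrC EFinM.
rewrite nneseriesZl/=; last by move=> n _; rewrite lee_fin divr_ge0// exprn_ge0.
congr *%E; rewrite expRE -EFin_lim; last first.
  rewrite /pseries/=; under eq_fun do rewrite mulrC.
  exact: is_cvg_series_exp_coeff.
apply/congr_lim/funext => n/=; rewrite /pseries/= /series/= -sumEFin//.
by under eq_bigr do rewrite mulrC.
Qed.

Lemma poisson_weight_le1 x k : poisson_weight x k <= 1.
Proof.
rewrite -lee_fin -(poisson_weight_sum x) (nneseriesD1 (n := k))//.
  rewrite leeDl// nneseries_ge0// => n _ _.
  by rewrite lee_fin poisson_weight_ge0.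
by move=> n _; rewrite lee_fin poisson_weight_ge0.
Qed.

End poisson_weight.

(** * Discrete decompositions and limits of probabilities *)

Section probability_lemmas.
Context d (T : measurableType d) (R : realType) (P : probability T R).

Lemma pickle_fiber (I : countType) n :
  (exists i, [set j : I | pickle j = n] = [set i]) \/
  [set j : I | pickle j = n] = set0.
Proof.
case E : (@pickle_inv I n) => [i|].
  left; exists i; apply/seteqP; split=> [j /= jn|j /= ->].
    by have := pickleK_inv j; rewrite jn E => -[].
  by have := @pickle_invK I n; rewrite E.
by right; apply/seteqP; split=> // j /= jn; have := pickleK_inv j; rewrite jn E.
Qed.

(** Countable additivity over the fibers of a discrete map.  [F] may be given by
    evaluating a process at a random time, so its measurability is a conclusion:
    only its trace on each fiber, where that time is fixed, is known to be
    measurable. *)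
Lemma probability_fibers (I : countType) (X : T -> I) (F : set T) :
  (forall i, measurable (F `&` X @^-1` [set i])) ->
  measurable F /\
  P F = (\sum_(n <oo) P (F `&` X @^-1` [set i | pickle i = n]))%E.
Proof.
move=> mFX.
have mFn n : measurable (F `&` X @^-1` [set i | pickle i = n]).
  have [[i ->]|->] := @pickle_fiber I n; first exact: mFX.
  by rewrite preimage_set0 setI0.
have FE : F = \bigcup_n (F `&` X @^-1` [set i | pickle i = n]).
  apply/seteqP; split=> [w Fw|w [n _ []//]].
  by exists (pickle (X w)).
split; first by rewrite FE; exact: bigcupT_measurable.
rewrite {1}FE measure_bigcup//.
  by apply: eq_eseriesl => n; rewrite in_setT.
by move=> m n _ _ [w [[_ /= <-] [_ /= <-]]].
Qed.

(** The law of total probability for a discrete map [X]: [c i] plays the role of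
    the conditional probability of [F] given [X = i]. *)
Lemma probability_fibers_integral (I : countType) (X : T -> I) (c : I -> R)
    (F : set T) :
  (forall i, 0 <= c i) ->
  (forall i, measurable (X @^-1` [set i])) ->
  (forall i, measurable (F `&` X @^-1` [set i])) ->
  (forall i, P (F `&` X @^-1` [set i]) = (c i)%:E * P (X @^-1` [set i]))%E ->
  [/\ measurable F, measurable_fun [set: T] (c \o X) &
  P F = (\int[P]_w (c (X w))%:E)%E].
Proof.
move=> c0 mX mFX FX.
have [mF PF] := probability_fibers mFX.
have mcX : measurable_fun [set: T] (c \o X).
  move=> _ B mB; rewrite setTI.
  have [] // := @probability_fibers I X ((c \o X) @^-1` B).
  move=> i; have [Bi|Bi] := pselect (B (c i)).
    rewrite (_ : _ `&` _ = X @^-1` [set i])//.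
    by apply/seteqP; split=> [w []//|w /= Xw]; rewrite /= Xw.
  rewrite (_ : _ `&` _ = set0)//.
  by apply/seteqP; split=> // w [] /= + Xw; rewrite Xw.
split => //; rewrite PF.
have -> : [set: T] = \bigcup_n X @^-1` [set i | pickle i = n].
  by apply/seteqP; split=> // w _; exists (pickle (X w)).
rewrite ge0_integral_bigcup//=.
- apply: eq_eseriesr => n _; have [[i ->]|->] := @pickle_fiber I n.
    rewrite FX (eq_integral (cst (c i)%:E)) ?integral_cst//.
    by move=> w; rewrite inE /= => ->.
  by rewrite preimage_set0 setI0 measure0 integral_set0.
- by move=> n; have [[i ->]|->] := @pickle_fiber I n; rewrite ?preimage_set0.
- by apply/measurable_EFinP; exact: measurable_funTS.
- by move=> w _; rewrite lee_fin.
- by move=> m n _ _ [w [/= <- /= <-]].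
Qed.

(** Dominated convergence for indicator functions. *)
Lemma probability_cvg (F_ : (set T)^nat) (F : set T) :
  (forall n, measurable (F_ n)) ->
  (forall w, \forall n \near \oo, F_ n w <-> F w) ->
  P (F_ n) @[n --> \oo] --> P F.
Proof.
move=> mF_ FF.
have cvgF w : ((\1_(F_ n) w : R)%:E @[n --> \oo] --> (\1_F w : R)%:E).
  apply: cvg_near_cst; near=> n; congr EFin; rewrite !indicE.
  by congr (_ %:R); congr nat_of_bool; apply/idP/idP; rewrite !inE;
    apply (near (FF w) n).
have mF : measurable F.
  apply/(measurable_indicP R)/measurable_EFinP.
  apply: (@emeasurable_fun_cvg _ _ _ _
    (fun n => EFin \o \1_(F_ n))) => [n|w _ /=]; last exact: cvgF.
  exact/measurable_EFinP/measurable_indic.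
have := @dominated_convergence _ T R P setT measurableT
  (fun n => EFin \o \1_(F_ n)) (EFin \o \1_F) (cst 1%E).
case=> //.
- by move=> n; exact/measurable_EFinP/measurable_indic.
- exact/measurable_EFinP/measurable_indic.
- by apply/aeW => w _; exact: cvgF.
- exact: finite_measure_integrable_cst.
- by apply/aeW => w n _ /=; rewrite lee_fin indicE ger0_norm//; case: (_ \in _).
move=> _ _; rewrite /= integral_indic// setIT.
by under eq_fun do rewrite integral_indic// setIT.
Unshelve. all: by end_near. Qed.

Lemma probability_almost_sure (A E : set T) :
  measurable A -> measurable E -> P (~` A) = 0%E -> P (A `&` E) = P E.
Proof.
move=> mA mE A0; rewrite [RHS](measureDI P mE mA) [in LHS]setIC.
suff DA0 : P (E `\` A) = 0%E by rewrite [X in _ = (X + _)%E]DA0 add0e.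
apply: subset_measure0 A0; [exact: measurableD|exact: measurableC|].
by move=> w [].
Qed.

(** On a full event where both variables are integer-valued, the atoms there
    determine the laws. *)
Lemma eq_law_nat_valued (A : set T) (X Y : T -> R) :
  measurable A -> P (~` A) = 0%E ->
  measurable_fun [set: T] X -> measurable_fun [set: T] Y ->
  (forall w, A w -> X w \is a Num.nat) ->
  (forall w, A w -> Y w \is a Num.nat) ->
  (forall k : nat,
    P (A `&` X @^-1` [set k%:R]) = P (A `&` Y @^-1` [set k%:R])) ->
  forall B, measurable B -> P (X @^-1` B) = P (Y @^-1` B).
Proof.
move=> mA A0 mX mY natX natY XY B mB.
have fibers (Z : T -> R) : measurable_fun [set: T] Z ->
    (forall w, A w -> Z w \is a Num.nat) ->
    P (Z @^-1` B) =
    (\sum_(n <oo) if n%:R \in B then P (A `&` Z @^-1` [set n%:R]) else 0)%E.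
  move=> mZ natZ.
  have mpre C : measurable C -> measurable (Z @^-1` C).
    by move=> mC; rewrite -[_ @^-1` _]setTI; exact: mZ.
  have fiber n :
      (A `&` Z @^-1` B) `&` (fun w => Num.trunc (Z w)) @^-1` [set n] =
      if n%:R \in B then A `&` Z @^-1` [set n%:R] else set0.
    case: ifPn => nB; apply/seteqP; split=> // w /=.
    - by move=> [[Aw ZB] <-]; split=> //; rewrite truncnK// natZ.
    - by move=> [Aw Zw]; rewrite Zw natrK; move: nB; rewrite inE.
    - move=> [[Aw ZB] nE]; move: nB; rewrite notin_setE -nE; apply.
      by rewrite truncnK// natZ.
  rewrite -(probability_almost_sure mA (mpre _ mB) A0).
  have [|_ ->] := @probability_fibers nat (fun w => Num.trunc (Z w))
    (A `&` Z @^-1` B).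
    move=> n; rewrite fiber; case: ifP => // _.
    by apply: measurableI => //; exact: mpre.
  apply: eq_eseriesr => n _; rewrite [X in P X](fiber n).
  by case: ifP; rewrite ?measure0.
by rewrite !fibers//; apply: eq_eseriesr => n _; rewrite XY.
Qed.

Lemma eq_law_integral (X Y : T -> R) (h : R -> R) :
  measurable_fun [set: T] X -> measurable_fun [set: T] Y ->
  (forall B, measurable B -> P (X @^-1` B) = P (Y @^-1` B)) ->
  measurable_fun [set: R] h -> (forall x, 0 <= h x) ->
  (\int[P]_w (h (X w))%:E = \int[P]_w (h (Y w))%:E)%E.
Proof.
move=> mX mY XY mh h0.
have mEh : measurable_fun [set: R] (EFin \o h) by exact/measurable_EFinP.
have push Z : measurable_fun [set: T] Z ->
    (\int[P]_w (h (Z w))%:E = \int[pushforward P Z]_x (h x)%:E)%E.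
  move=> mZ; rewrite ge0_integral_pushforward//.
  by move=> y _; rewrite lee_fin.
rewrite !push//; apply: eq_measure_integral => B mB _; exact: XY.
Qed.

End probability_lemmas.

(** * Rounding up to a grid *)

Section grid.
Context (R : realType).
Implicit Types x : R.

(** The least multiple of [1 / (n + 1)] strictly above a nonnegative [x].
    Strictness matters: right limits at [x] do not involve the value at [x]. *)
Definition grid (n : nat) (x : R) : R :=
  (Num.trunc (n.+1%:R * x)).+1%:R / n.+1%:R.

Lemma grid_gt n x : x < grid n x.
Proof. by rewrite /grid ltr_pdivlMr// mulrC truncnS_gt. Qed.

Lemma grid_le n x : 0 <= x -> grid n x <= x + n.+1%:R^-1.
Proof.
move=> x0; rewrite /grid ler_pdivrMr// mulrDl mulVf// -natr1 lerD2r mulrC.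
by rewrite truncn_le mulr_ge0.
Qed.

Lemma grid_homo n : {homo grid n : x y / x <= y}.
Proof.
move=> x y xy; rewrite /grid ler_pM2r ?invr_gt0// ler_nat ltnS.
by apply: le_truncn; rewrite ler_pM2l.
Qed.

Lemma grid_cvg x : 0 <= x -> grid ^~ x @ \oo --> x.
Proof.
move=> x0; apply: (@squeeze_cvgr _ _ _ _ (cst x) (fun n => x + n.+1%:R^-1)).
- by apply: nearW => n; rewrite /= ltW ?grid_gt// grid_le.
- exact: cvg_cst.
- rewrite -[X in _ --> X]addr0; apply: cvgD; first exact: cvg_cst.
  exact: cvg_harmonic.
Qed.

Lemma grid_cell_measurable n (a : nat) :
  measurable [set x : R | Num.trunc (n.+1%:R * x) = a].
Proof.
have mlt k : measurable [set x : R | (Num.trunc (n.+1%:R * x) <= k)%N].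
  rewrite (_ : [set _ | _] = `]-oo, (k.+1%:R / n.+1%:R)[%classic)//.
  apply/seteqP; split=> x /=;
  by rewrite truncn_le_nat in_itv/= ltr_pdivlMr// mulrC.
case: a => [|a].
  rewrite (_ : [set _ | _] = [set x : R | (Num.trunc (n.+1%:R * x) <= 0)%N])//.
  by apply/seteqP; split=> x /=; rewrite leqn0 => /eqP.
rewrite (_ : [set _ | _] = [set x : R | (Num.trunc (n.+1%:R * x) <= a.+1)%N] `\`
   [set x : R | (Num.trunc (n.+1%:R * x) <= a)%N]); first exact: measurableD.
apply/seteqP; split=> x /=; first by move=> ->; split=> //; rewrite ltnn.
by case=> h /negP; rewrite -ltnNge => h'; apply/eqP; rewrite eqn_leq h.
Qed.

End grid.

(** * Poisson processes at random times *)

Section process_events.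
Context d (T : measurableType d) (R : realType) (P : probability T R).
Implicit Types X : R -> {RV P >-> R}.

Lemma process_event X (t : R) (B : set R) :
  0 <= t -> measurable B -> <<s process_events X >> (X t @^-1` B).
Proof.
move=> t0 mB; apply: sub_sigma_algebra; exists t => //.
by exists B => //; rewrite setTI.
Qed.

Lemma process_eventI X (A B : set T) :
  <<s process_events X >> A -> <<s process_events X >> B ->
  <<s process_events X >> (A `&` B).
Proof.
exact: (@measurableI _ (g_sigma_algebraType (process_events X)) A B).
Qed.

Lemma increment_measurable X s t :
  measurable_fun [set: T] (increment X s t).
Proof. exact: measurable_funB. Qed.

End process_events.

Section poisson_at_random_times.
Context d (T : measurableType d) (R : realType) (P : probability T R).
Context (lam : R) (N : R -> {RV P >-> R}).
Context (lam_gt0 : 0 < lam) (poissonN : poisson_process lam N).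

Lemma poisson_increment_law (s t : R) (k : nat) : 0 <= s -> s <= t ->
  P (increment N s t @^-1` [set k%:R]) = (poisson_weight (lam * (t - s)) k)%:E.
Proof.
move=> s0; have [N0 natN _ _ lawN] := poissonN.
rewrite le_eqVlt => /orP[/eqP <-|st]; last first.
  by rewrite lawN// poisson_weight_pmf// mulr_gt0// subr_gt0.
rewrite subrr mulr0 /poisson_weight normr0 oppr0 expR0 mulr1 /increment.
case: k => [|k].
  rewrite expr0 fact0 divr1 (_ : _ @^-1` _ = setT) ?probability_setT//.
  by apply/seteqP; split => // w _ /=; rewrite subrr.
rewrite expr0n/= mul0r (_ : _ @^-1` _ = set0) ?measure0//.
apply/seteqP; split => // w /=; rewrite subrr => /eqP.
by rewrite eq_sym pnatr_eq0.
Qed.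

Lemma poisson_two_points (a b : R) (j m : nat) : 0 <= a -> a <= b ->
  P [set w | N a w = j%:R /\ N b w = (j + m)%:R] =
  (poisson_weight (lam * a) j * poisson_weight (lam * (b - a)) m)%:E.
Proof.
move=> a0 ab; have [N0 _ _ indepN _] := poissonN.
pose t (i : nat) : R := if i is i'.+1 then (if i' is 0%N then a else b) else 0.
pose B (i : nat) : set R := [set (if i is 0%N then j else m)%:R].
have := indepN 2%N t B.
rewrite big_ord_recr big_ord1 /= !poisson_increment_law// subr0 -EFinM => <-//.
- congr (P _); apply/seteqP; split => w /=.
    move=> [Na Nb] [|[|//]] _; rewrite /increment/= ?N0 ?subr0//.
    by rewrite Na Nb natrD addrC addKr.
  move=> h; have /= := h 0%N erefl; have /= := h 1%N erefl.
  rewrite /B /increment/= N0 subr0 => + Na; rewrite Na => /eqP.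
  by rewrite subr_eq addrC -natrD => /eqP.
- by case=> [|[|//]].
- by move=> i; exact: measurable_set1.
Qed.

(** The product rule on the rectangles [C1] times [C2] expresses that the pair
    [(U, V)] is independent of [N]. *)
Lemma poisson_at_random_times (U V : {RV P >-> R}) (j m : nat) :
  (forall w, 0 <= U w <= V w) ->
  (forall A C1 C2, <<s process_events N >> A -> measurable C1 ->
    measurable C2 ->
    P (A `&` (U @^-1` C1 `&` V @^-1` C2)) =
    P A * P (U @^-1` C1 `&` V @^-1` C2))%E ->
  P [set w | N (U w) w = j%:R /\ N (V w) w = (j + m)%:R] =
  (\int[P]_w (poisson_weight (lam * U w) j *
              poisson_weight (lam * (V w - U w)) m)%:E)%E.
Proof.
move=> UV indep; have [_ natN pathN _ _] := poissonN.
have U0 w : 0 <= U w by case/andP: (UV w).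
have V0 w : 0 <= V w by case/andP: (UV w); exact: le_trans.
pose F_ n := [set w | N (grid n (U w)) w = j%:R /\
  N (grid n (V w)) w = (j + m)%:R].
pose g (u v : R) :=
  poisson_weight (lam * u) j * poisson_weight (lam * (v - u)) m.
have g_ge0 u v : 0 <= g u v by rewrite mulr_ge0// poisson_weight_ge0.
pose node n (a : nat) : R := a.+1%:R / n.+1%:R.
pose X n w := (Num.trunc (n.+1%:R * U w), Num.trunc (n.+1%:R * V w)).
(* At the rounded times: the cells of the grid that contain [U] and [V] form
   the discrete map [X n], and given [X n = ab] the rounded times are the nodes
   of [ab]. *)
have discrete n : [/\ measurable (F_ n),
    measurable_fun setT (fun w => g (grid n (U w)) (grid n (V w))) &
    P (F_ n) = (\int[P]_w (g (grid n (U w)) (grid n (V w)))%:E)%E].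
  pose G ab := [set w | N (node n ab.1) w = j%:R /\
    N (node n ab.2) w = (j + m)%:R].
  have XE ab : X n @^-1` [set ab] =
      U @^-1` [set x | Num.trunc (n.+1%:R * x) = ab.1] `&`
      V @^-1` [set x | Num.trunc (n.+1%:R * x) = ab.2].
    case: ab => a b; apply/seteqP; split=> w; rewrite /X/=; first by case.
    by case=> -> ->.
  have mX ab : measurable (X n @^-1` [set ab]).
    rewrite XE; apply: measurableI; apply: measurable_funPTI => //;
    exact: grid_cell_measurable.
  have FX ab : F_ n `&` X n @^-1` [set ab] = G ab `&` X n @^-1` [set ab].
    by apply/seteqP; split=> w [+ Xw]; rewrite /F_ /G /grid /node/= -Xw.
  have mG ab : measurable (G ab).
    by apply: measurableI; exact: (measurable_funPTI (N _) (measurable_set1 _)).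
  apply: (@probability_fibers_integral _ _ _ _ _ (X n)
    (fun ab => g (node n ab.1) (node n ab.2))) => // ab.
    by rewrite FX; exact: measurableI.
  rewrite FX; have [ab12|ab12] := leqP ab.1 ab.2.
    have sG : <<s process_events N >> (G ab).
      apply: (process_eventI (A := N (node n ab.1) @^-1` [set j%:R])
        (B := N (node n ab.2) @^-1` [set (j + m)%:R]));
      by apply: process_event; rewrite ?divr_ge0.
    rewrite XE indep//; try exact: grid_cell_measurable.
    rewrite -poisson_two_points// ?divr_ge0//.
    by rewrite ler_pM2r ?invr_gt0// ler_nat.
  (* [U <= V], so no outcome has the node of [U] beyond that of [V] *)
  rewrite (_ : X n @^-1` _ = set0) ?setI0 ?measure0 ?mule0//.
  apply/seteqP; split=> // w Xw; move: ab12; rewrite -Xw /= ltnNge.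
  by rewrite le_truncn// ler_pM2l//; case/andP: (UV w).
(* The path is nondecreasing, integer-valued and right-continuous, so it is
   constant just after [Z w]. *)
have rc (Z : {RV P >-> R}) w (k : nat) : 0 <= Z w ->
    \forall n \near \oo, N (grid n (Z w)) w = k%:R <-> N (Z w) w = k%:R.
  move=> Z0; have NZ : N (grid n (Z w)) w @[n --> \oo] --> N (Z w) w.
    have /cvg_at_rightP/(_ (fun n => grid n (Z w))) := (pathN w).2 (Z w) Z0.
    by apply; split=> [n|]; [exact: grid_gt|exact: grid_cvg].
  near=> n.
  suff -> : N (grid n (Z w)) w = N (Z w) w by [].
  have : N (grid n (Z w)) w < N (Z w) w + 1.
    by near: n; apply: (cvgr_lt (N (Z w) w)) => //; rewrite ltrDl.
  have : N (Z w) w <= N (grid n (Z w)) w.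
    by apply: (pathN w).1 => //; exact/ltW/grid_gt.
  have /natrP[a ->] := natN (Z w) w Z0.
  have /natrP[b ->] :=
    natN (grid n (Z w)) w (ltW (le_lt_trans Z0 (grid_gt n _))).
  rewrite natr1 ler_nat ltr_nat ltnS => ab ba.
  by congr _%:R; apply/eqP; rewrite eqn_leq ab ba.
have lhs : P (F_ n) @[n --> \oo] -->
    P [set w | N (U w) w = j%:R /\ N (V w) w = (j + m)%:R].
  apply: probability_cvg => [n|w]; first by have [] := discrete n.
  near=> n; have hU : N (grid n (U w)) w = j%:R <-> N (U w) w = j%:R.
    by near: n; exact: rc.
  have hV : N (grid n (V w)) w = (j + m)%:R <-> N (V w) w = (j + m)%:R.
    by near: n; exact: rc.
  by rewrite /F_ /=; tauto.
have rhs : (\int[P]_w (g (grid n (U w)) (grid n (V w)))%:E)%E @[n --> \oo] -->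
    (\int[P]_w (g (U w) (V w))%:E)%E.
  have cvg_g w : (g (grid n (U w)) (grid n (V w)) @[n --> \oo] -->
      g (U w) (V w)).
    have cvg_weight (h : R^nat) (l : R) k : h n @[n --> \oo] --> l ->
        poisson_weight (lam * h n) k @[n --> \oo] -->
        poisson_weight (lam * l) k.
      move=> hl; have lhl : lam * h n @[n --> \oo] --> lam * l.
        by apply: cvgM => //; exact: cvg_cst.
      exact: (cvg_comp _ _ lhl (@continuous_poisson_weight R k _)).
    apply: cvgM; first exact/cvg_weight/grid_cvg.
    apply: (cvg_weight (fun n => grid n (V w) - grid n (U w))).
    by apply: cvgB; exact: grid_cvg.
  have [] // := @dominated_convergence _ T R P setT measurableT
    (fun n w => (g (grid n (U w)) (grid n (V w)))%:E)
    (fun w => (g (U w) (V w))%:E) (cst 1%E).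
  - by move=> n; apply/measurable_EFinP; have [] := discrete n.
  - apply/measurable_EFinP; apply: measurable_fun_cvg (fun w _ => cvg_g w) => n.
    by have [] := discrete n.
  - apply/aeW => w _; apply: (@cvg_comp _ _ _ _ EFin _ _ _ (cvg_g w)).
    exact: cvg_id.
  - exact: finite_measure_integrable_cst.
  - apply/aeW => w n _ /=; rewrite lee_fin ger0_norm//.
    by rewrite mulr_ile1// ?poisson_weight_ge0 ?poisson_weight_le1.
have FE : P \o F_ = (fun n => \int[P]_w (g (grid n (U w)) (grid n (V w)))%:E)%E.
  by apply/funext => n; have [] := discrete n.
rewrite -FE in rhs.
exact: (cvg_unique _ lhs rhs).
Unshelve. all: by end_near. Qed.

End poisson_at_random_times.

(** * The space fractional Polya process *)

Section sfpp.
Context d (T : measurableType d) (R : realType) (P : probability T R).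
Context (D : R -> {RV P >-> R}).
Context (D0 : forall w, D 0 w = 0) (pathD : nondecreasing_cadlag_paths D).

Lemma subordinator_ge0 t w : 0 <= t -> 0 <= D t w.
Proof. by move=> t0; rewrite -(D0 w); apply: (pathD w).1. Qed.

Lemma subordinated_poisson_two_points (lam : R) (N : R -> {RV P >-> R})
    (s t : R) (j m : nat) :
  0 < lam -> poisson_process lam N -> independent_processes N D ->
  0 <= s -> 0 <= t ->
  P [set w | N (D s w) w = j%:R /\ N (D (s + t) w) w = (j + m)%:R] =
  (\int[P]_w (poisson_weight (lam * D s w) j *
              poisson_weight (lam * increment D s (s + t) w) m)%:E)%E.
Proof.
move=> lam0 poissonN indep s0 t0.
apply: (poisson_at_random_times lam0 poissonN) => [w|A C1 C2 NA mC1 mC2].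
  by rewrite subordinator_ge0//=; apply: (pathD w).1; rewrite // lerDl.
apply: indep => //; apply: process_eventI; apply: process_event => //.
exact: addr_ge0.
Qed.

Context (N : R -> R -> {RV P >-> R}) (Gam : {RV P >-> R})
  (W : R -> {RV P >-> R}).
Context (poissonN : forall lam : R, 0 < lam -> poisson_process lam (N lam))
  (indepND : forall lam : R, 0 < lam -> independent_processes (N lam) D)
  (sfppW : space_fractional_polya D N Gam W).

Lemma sfpp_nat t w : 0 <= t -> 0 < Gam w -> W t w \is a Num.nat.
Proof.
move=> t0 G0; rewrite sfppW.1// /space_fractional_poisson.
have [_ natN _ _ _] := poissonN G0.
by apply: natN; exact: subordinator_ge0.
Qed.

Lemma sfpp_nondecreasing s t w :
  0 <= s -> s <= t -> 0 < Gam w -> W s w <= W t w.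
Proof.
move=> s0 st G0; have t0 := le_trans s0 st.
rewrite !sfppW.1// /space_fractional_poisson.
have [_ _ pathN _ _] := poissonN G0.
by apply: (pathN w).1; [exact: subordinator_ge0|exact: (pathD w).1].
Qed.

Lemma sfpp_increment_nat s t w : 0 <= s -> s <= t -> 0 < Gam w ->
  increment W s t w \is a Num.nat.
Proof.
move=> s0 st G0; have := sfpp_nondecreasing s0 st G0.
rewrite /increment.
have /natrP[a ->] := sfpp_nat s0 G0.
have /natrP[b ->] := sfpp_nat (le_trans s0 st) G0.
by rewrite ler_nat => ab; rewrite -natrB.
Qed.

Lemma sfpp_two_points s t (j m : nat) : 0 <= s -> 0 <= t ->
  P (Gam @^-1` `]0, +oo[ `&`
     [set w | W s w = j%:R /\ W (s + t) w = (j + m)%:R]) =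
  (\int[distribution P Gam]_(lam in `]0%R, +oo[)
    \int[P]_w (poisson_weight (lam * D s w) j *
               poisson_weight (lam * increment D s (s + t) w) m)%:E)%E.
Proof.
move=> s0 t0.
pose tt (i : 'I_2) := if i == ord0 then s else s + t.
pose B (i : 'I_2) : set R := if i == ord0 then [set j%:R] else [set (j + m)%:R].
have two (Z : R -> T -> R) :
    [set w | Z s w = j%:R /\ Z (s + t) w = (j + m)%:R] =
    [set w | forall i, B i (Z (tt i) w)].
  apply/seteqP; split=> w /=.
    by move=> [Zs Zt] i; rewrite /B /tt; case: ifP.
  by move=> h; split; [exact: (h ord0)|exact: (h ord_max)].
rewrite (two (fun u => W u)) sfppW.2//.
- apply: eq_integral => lam; rewrite inE /= in_itv/= andbT => lam0.
  rewrite -(two (fun u => space_fractional_poisson D (N lam) u)).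
  exact: (subordinated_poisson_two_points _ _ lam0 (poissonN lam0)
    (indepND lam0)).
- by move=> i; rewrite /tt; case: ifP => // _; exact: addr_ge0.
- by move=> i; rewrite /B; case: ifP.
Qed.

(** Sum [sfpp_two_points] over the value [j] of [W s]; the weights of [j] add up
    to one under both integrals. *)
Lemma sfpp_increment_law s t (m : nat) : 0 <= s -> 0 <= t ->
  P (Gam @^-1` `]0, +oo[ `&` increment W s (s + t) @^-1` [set m%:R]) =
  (\int[distribution P Gam]_(lam in `]0%R, +oo[)
    \int[P]_w (poisson_weight (lam * increment D s (s + t) w) m)%:E)%E.
Proof.
move=> s0 t0.
pose A := Gam @^-1` `]0, +oo[.
have mA : measurable A by exact: measurable_funPTI.
have fiber n : (A `&` increment W s (s + t) @^-1` [set m%:R]) `&`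
    (fun w => Num.trunc (W s w)) @^-1` [set n] =
    A `&` [set w | W s w = n%:R /\ W (s + t) w = (n + m)%:R].
  apply/seteqP; split=> w /=.
    rewrite /increment => -[[Aw Wm] <-]; split => //.
    have G0 : 0 < Gam w by move: Aw; rewrite /A/= in_itv/= andbT.
    rewrite natrD truncnK//; last exact: sfpp_nat.
    by split=> //; rewrite -Wm [RHS]addrC subrK.
  move=> [Aw [Ws Wt]]; rewrite /increment Ws Wt natrK.
  by rewrite natrD [X in X - _]addrC addrK.
have [|_ ->] := @probability_fibers _ _ _ P nat (fun w => Num.trunc (W s w))
    (A `&` increment W s (s + t) @^-1` [set m%:R]).
  move=> n; rewrite fiber; apply: measurableI => //; apply: measurableI.
    exact: (measurable_funPTI (W _) (measurable_set1 _)).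
  exact: (measurable_funPTI (W _) (measurable_set1 _)).
transitivity (\sum_(j <oo) \int[distribution P Gam]_(lam in `]0%R, +oo[)
    \int[P]_w (poisson_weight (lam * D s w) j *
               poisson_weight (lam * increment D s (s + t) w) m)%:E)%E.
  by apply: eq_eseriesr => n _; rewrite [X in P X](fiber n) sfpp_two_points.
(* Joint measurability in [(lam, w)] is what allows the sum over [j] to pass
   under the integral in [lam]. *)
have mjoint j : measurable_fun [set: R * T] (fun z =>
    (poisson_weight (z.1 * D s z.2) j *
     poisson_weight (z.1 * increment D s (s + t) z.2) m)%:E).
  apply/measurable_EFinP; apply: measurable_funM.
    apply: measurable_poisson_weight.
    by apply: measurable_funM => //; exact: measurableT_comp.
  apply: measurable_poisson_weight.
  apply: measurable_funM => //; apply: measurableT_comp => //.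
  exact: increment_measurable.
rewrite -integral_nneseries//.
- apply: eq_integral => lam _; rewrite -integral_nneseries//.
  + apply: eq_integral => w _.
    under eq_eseriesr do rewrite mulrC EFinM.
    rewrite nneseriesZl//; last by move=> *; rewrite lee_fin poisson_weight_ge0.
    by rewrite poisson_weight_sum mule1.
  + move=> j; exact: (measurable_fun_pair2 lam (mjoint j)).
  + by move=> j w _; rewrite lee_fin mulr_ge0// poisson_weight_ge0.
- move=> j; apply: measurable_funTS.
  apply: (measurable_fun_fubini_tonelli_F (m2 := P) _ (mjoint j)) => z.
  by rewrite lee_fin mulr_ge0// poisson_weight_ge0.
- move=> j lam _; apply: integral_ge0 => w _.
  by rewrite lee_fin mulr_ge0// poisson_weight_ge0.
Qed.

Context (statD : stationary_increments D)
  (Gam_gt0 : P (~` (Gam @^-1` `]0, +oo[)) = 0%E).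

Lemma sfpp_stationary_increments : stationary_increments W.
Proof.
move=> s t s0 t0; apply: (eq_law_nat_valued (A := Gam @^-1` `]0, +oo[)) => //.
- exact: measurable_funPTI.
- exact: increment_measurable.
- exact: increment_measurable.
- move=> w /=; rewrite in_itv/= andbT; apply: sfpp_increment_nat => //.
  by rewrite lerDl.
- by move=> w /=; rewrite in_itv/= andbT; exact: sfpp_increment_nat.
move=> m; have law0 := sfpp_increment_law m (lexx 0) t0; rewrite add0r in law0.
apply: (etrans (sfpp_increment_law m s0 t0)); apply: (etrans _ (esym law0)).
apply: eq_integral => lam _.
apply: (eq_law_integral (h := fun x => poisson_weight (lam * x) m)).
- exact: increment_measurable.
- exact: increment_measurable.
- exact: statD.
- apply: measurable_poisson_weight.
  exact: measurable_funM.
- by move=> x; exact: poisson_weight_ge0.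
Qed.

(** Stationarity moves every increment to time [0], where the paths of [W] are
    controlled by monotonicity and the right-continuity of [D] and [N]. *)
Lemma sfpp_stochastically_continuous : stochastically_continuous W.
Proof.
move=> t t0 e e0.
pose A := Gam @^-1` `]0, +oo[.
have mA : measurable A by exact: measurable_funPTI.
pose Be : set R := [set x | e < `|x|].
have mBe : measurable Be.
  rewrite (_ : Be = (@Num.norm R R) @^-1` `]e, +oo[); last first.
    by apply/seteqP; split=> x /=; rewrite in_itv/= andbT.
  by rewrite -[_ @^-1` _]setTI; exact: normr_measurable.
pose G h := A `&` increment W 0 h @^-1` Be.
have mG h : measurable (G h).
  apply: measurableI => //; rewrite -[_ @^-1` _]setTI.
  exact: increment_measurable.
have shift s : 0 <= s -> P [set w | e < `|W s w - W t w|] = P (G `|s - t|).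
  move=> s0; rewrite /G probability_almost_sure//; last first.
    by rewrite -[_ @^-1` _]setTI; exact: increment_measurable.
  have [st|ts] := leP s t.
    have ts0 : 0 <= t - s by rewrite subr_ge0.
    rewrite distrC ger0_norm// -(sfpp_stationary_increments s0 ts0 mBe).
    congr (P _); apply/seteqP; split=> w /=; rewrite /Be /increment/= distrC;
    by rewrite (addrC s) subrK.
  have ts0 : 0 <= s - t by rewrite subr_ge0 ltW.
  rewrite ger0_norm// -(sfpp_stationary_increments t0 ts0 mBe).
  by rewrite addrC subrK.
have Gmono h h' : 0 <= h -> h <= h' -> G h `<=` G h'.
  move=> h0 hh' w [Aw]; have G0 : 0 < Gam w.
    by move: Aw; rewrite /A/= in_itv/= andbT.
  rewrite /Be /increment /= => eh; split=> //=; apply: lt_le_trans eh _.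
  have h'0 := le_trans h0 hh'.
  rewrite !ger0_norm ?subr_ge0 ?sfpp_nondecreasing// lerD2r.
  exact: sfpp_nondecreasing.
(* Choose [x > 0] with [N (Gam w) x w < e], then [h > 0] with [D h w < x]; by
   monotonicity [W k w < e] whenever [0 <= k <= h]. *)
have G_small w : \forall n \near \oo, G n.+1%:R^-1 w <-> set0 w.
  have [Aw|nAw] := pselect (A w); last by apply: nearW => n; split=> // -[].
  have G0 : 0 < Gam w by move: Aw; rewrite /A/= in_itv/= andbT.
  have [N0 _ pathN _ _] := poissonN G0.
  have [x [x0 Nx]] : exists x, 0 < x /\ N (Gam w) x w < e.
    have N_lt : \forall x \near 0^'+, N (Gam w) x w < e.
      have := (pathN w).2 0 (lexx 0); rewrite N0 => /cvgr_lt; exact.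
    have /filter_ex[x [x0 Nx]] : \forall x \near 0^'+,
        0 < x /\ N (Gam w) x w < e.
      by near=> x; split; [near: x; exact: nbhs_right_gt|near: x].
    by exists x.
  have [h [h0 Dh]] : exists h, 0 < h /\ D h w < x.
    have D_lt : \forall h \near 0^'+, D h w < x.
      have := (pathD w).2 0 (lexx 0); rewrite D0 => /cvgr_lt; exact.
    have /filter_ex[h [h0 Dh]] : \forall h \near 0^'+, 0 < h /\ D h w < x.
      by near=> h; split; [near: h; exact: nbhs_right_gt|near: h].
    by exists h.
  near=> n; split=> // -[_] /=; rewrite /Be /increment /= => eW.
  have n0 : 0 <= n.+1%:R^-1 :> R by rewrite invr_ge0.
  suff : `|W n.+1%:R^-1 w - W 0 w| < e by rewrite ltNge (ltW eW).
  rewrite ger0_norm; last by rewrite subr_ge0 sfpp_nondecreasing.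
  rewrite !sfppW.1// /space_fractional_poisson D0 N0 subr0.
  apply: le_lt_trans Nx; apply: (pathN w).1; first exact: subordinator_ge0.
  apply: le_trans (ltW Dh); apply: (pathD w).1 => //.
  by apply: ltW; near: n; exact: (near_infty_natSinv_lt (PosNum h0)).
have /= cvgG : P (G n.+1%:R^-1) @[n --> \oo] --> 0%E.
  rewrite -(measure0 P); apply: probability_cvg => // n; exact: mG.
have PE s : 0 <= s ->
    P [set w | e < `|W s w - W t w|] = (fine (P (G `|s - t|)))%:E.
  by move=> s0; rewrite shift// fineK// fin_num_measure.
apply: (@cvg_EFin _ _ _ _ (fun s => P [set w | e < `|W s w - W t w|]) 0).
  near=> s; rewrite PE//; near: s; exact: withinT.
apply/cvgr0Pnorm_lt => eps eps0.
have /fine_cvgP[_ /cvgr0Pnorm_lt/(_ _ eps0)] := cvgG.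
move=> [n _ /(_ n (leqnn n)) /= Gn].
near=> s.
have s0 : 0 <= s by near: s; exact: withinT.
have st : `|s - t| <= n.+1%:R^-1.
  rewrite distrC; near: s; apply: cvg_within.
  have n0 : 0 < n.+1%:R^-1 :> R by rewrite invr_gt0.
  exact: (@cvgr_dist_le R R R (nbhs t) _ idfun t cvg_id _ n0).
apply: le_lt_trans Gn; rewrite /= PE//=.
rewrite [leLHS]ger0_norm ?fine_ge0// [leRHS]ger0_norm ?fine_ge0//.
rewrite fine_le ?fin_num_measure// le_measure ?inE//; exact: Gmono.
Unshelve. all: by end_near. Qed.

End sfpp.

(** The gamma density vanishes on the nonpositive half-line. *)
Lemma gamma_distributed_gt0 d (T : measurableType d) (R : realType)
    (P : probability T R) (alpha p : R) (Gam : {RV P >-> R}) :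
  gamma_distributed alpha p Gam -> P (~` (Gam @^-1` `]0, +oo[)) = 0%E.
Proof.
move=> /(_ `]-oo, 0]%classic (measurable_itv _)) gammaG.
rewrite (_ : ~` _ = Gam @^-1` `]-oo, 0]); last first.
  apply/seteqP; split=> w /=; rewrite !in_itv/= andbT; last first.
    by rewrite leNgt => /negP.
  by move/negP; rewrite -leNgt.
rewrite -[LHS]/(distribution P Gam _) gammaG; apply: integral0_eq => y.
by rewrite /= in_itv/= /gamma_pdf ltNge => ->.
Qed.

Theorem theorem5p2 (d : measure_display) (T : measurableType d) (R : realType)
    (P : probability T R) (beta alpha p : R)
    (D : R -> {RV P >-> R}) (N : R -> R -> {RV P >-> R})
    (Gam : {RV P >-> R}) (W : R -> {RV P >-> R})
    (beta_gt0 : 0 < beta) (beta_le1 : beta <= 1)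
    (alpha_gt0 : 0 < alpha) (p_gt0 : 0 < p)
    (stableD : stable_subordinator beta D)
    (poissonN : forall lam : R, 0 < lam -> poisson_process lam (N lam))
    (indepND : forall lam : R, 0 < lam -> independent_processes (N lam) D)
    (gammaG : gamma_distributed alpha p Gam)
    (indepG : forall lam : R, 0 < lam ->
       rv_independent_of_processes Gam D (N lam))
    (sfppW : space_fractional_polya D N Gam W) :
  stationary_increments W /\ stochastically_continuous W.
Proof.
have [D0 pathD _ statD _] := stableD.
have Gam_gt0 := gamma_distributed_gt0 gammaG.
split.
  exact: (sfpp_stationary_increments D0 pathD poissonN indepND sfppW statD
    Gam_gt0).
exact: (sfpp_stochastically_continuous D0 pathD poissonN indepND sfppW statD
  Gam_gt0).
Qed.
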